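(* If a cubic vector field $\chi=(P,Q,R)$ on $\mathbb{T}^2$ has exactly two invariant parallel planes, then $P,Q,R$ satisfy $$P=\tfrac12 xz(px+qy)+fy-\tfrac{a^2p}{2}z,\qquad Q=\tfrac12 yz(px+qy)-fx-\tfrac{a^2q}{2}z,\qquad R=(px+qy)(z^2-1)$$ for some $f\in\mathbb{R}[x,y,z]$ with $\deg f\leq 2$ and some $p,q\in\mathbb{R}$. Moreover, $z-1=0$ and $z+1=0$ are the invariant parallel planes of this vector field. Also, the parallel on $z-1=0$ is a periodic orbit if and only if $f(x,y,1)-\frac12(py-qx)=0$ has no solution on the circle $x^2+y^2=a^2$, and the parallel on $z+1=0$ is a periodic orbit if and only if $f(x,y,-1)+\frac12(py-qx)=0$ has no solution on the circle $x^2+y^2=a^2$.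
   Context: Fix a real number $a>1$ and let $\mathbb{T}^2=\{(x,y,z)\in\mathbb{R}^3:(x^2+y^2-a^2)^2+z^2-1=0\}$. A triple $\chi=(P,Q,R)$ with $P,Q,R\in\mathbb{R}[x,y,z]$ denotes the polynomial vector field $P\frac{\partial}{\partial x}+Q\frac{\partial}{\partial y}+R\frac{\partial}{\partial z}$ in $\mathbb{R}^3$, acting on polynomials as a derivation; its degree is $\max\{\deg P,\deg Q,\deg R\}$, and it is cubic if its degree is $3$. An algebraic surface $\{g=0\}$ is invariant for $\chi$ if $\chi g=Lg$ for some $L\in\mathbb{R}[x,y,z]$; $\chi$ is a vector field on $\mathbb{T}^2$ if $\{(x^2+y^2-a^2)^2+z^2-1=0\}$ is invariant in this sense. A parallel plane is a plane $\{z-k=0\}$ with $-1\leq k\leq 1$; the curves in its intersection with $\mathbb{T}^2$ are called parallels (for $k=\pm1$ there is a single one, the circle $x^2+y^2=a^2$, $z=k$). Invariant parallel planes are counted with multiplicity: the multiplicity of an invariant plane $\{z-k=0\}$ is the largest $m$ such that $(z-k)^m$ divides the extactic polynomial of $\chi$ associated with $\langle 1,z\rangle$, which is $\begin{vmatrix}1&z\\ \chi(1)&\chi(z)\end{vmatrix}=R$, and it is infinite if $R=0$. *)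

(* Defs.v *)
(* [mpoly] has to be imported before the analysis files,
   as the notations of the two libraries clash in the other order. *)
From HB Require Import structures.
From mathcomp Require Import all_boot all_order all_algebra.
From mathcomp Require Import mpoly.
From mathcomp Require Import boolp classical_sets reals topology normedtype derive.

Set Implicit Arguments.
Unset Strict Implicit.
Unset Printing Implicit Defensive.

Import Order.TTheory GRing.Theory Num.Theory.
Import numFieldNormedType.Exports.
Local Open Scope classical_set_scope.
Local Open Scope ring_scope.

Definition varx (K : realType) : {mpoly K[3]} := 'X_(@Ordinal 3 0 isT).
Definition vary (K : realType) : {mpoly K[3]} := 'X_(@Ordinal 3 1 isT).
Definition varz (K : realType) : {mpoly K[3]} := 'X_(@Ordinal 3 2 isT).

Arguments varx {K}.
Arguments vary {K}.
Arguments varz {K}.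

Definition vec3 (K : realType) (u v w : K) : 'rV[K]_3 :=
  \row_i tnth [tuple u; v; w] i.

Definition eval_at (K : realType) (g : {mpoly K[3]}) (v : 'rV[K]_3) : K :=
  g.@[fun i => v ord0 i].

Definition zero_set (K : realType) (g : {mpoly K[3]}) : set 'rV[K]_3 :=
  [set v | eval_at g v = 0].

(* [msize] is one more than the total degree, and 0 for the zero polynomial;
   the zero polynomial gets degree 0 here. *)
Definition degree (K : realType) (g : {mpoly K[3]}) : nat := (msize g).-1.

(* A vector field P d/dx + Q d/dy + R d/dz is the triple [tuple P; Q; R]. *)
Definition vfield (K : realType) := 3.-tuple {mpoly K[3]}.

Definition vf_degree (K : realType) (chi : vfield K) : nat :=
  (\max_(i < 3) degree (tnth chi i))%N.

Definition derivation (K : realType) (chi : vfield K) (g : {mpoly K[3]}) :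
    {mpoly K[3]} :=
  \sum_(i < 3) tnth chi i * mderiv i g.

Definition invariant_surface (K : realType) (chi : vfield K)
    (g : {mpoly K[3]}) : Prop :=
  exists L : {mpoly K[3]}, derivation chi g = L * g.

Definition torus_poly (K : realType) (a : K) : {mpoly K[3]} :=
  (varx ^+ 2 + vary ^+ 2 - (a ^+ 2)%:MP) ^+ 2 + varz ^+ 2 - 1.

Definition plane_poly (K : realType) (k : K) : {mpoly K[3]} := varz - k%:MP.

Definition invariant_parallel_plane (K : realType) (chi : vfield K) (k : K) :
    Prop :=
  -1 <= k <= 1 /\ invariant_surface chi (plane_poly k).

(* Row i of the determinant lists the i-fold derivatives of the v_j. *)
Definition extactic (K : realType) (n : nat) (chi : vfield K)
    (v : n.-tuple {mpoly K[3]}) : {mpoly K[3]} :=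
  \det (\matrix_(i < n, j < n) iter i (derivation chi) (tnth v j)).

Definition mp_dvd (K : realType) (g h : {mpoly K[3]}) : Prop :=
  exists q : {mpoly K[3]}, h = q * g.

(* No m qualifies when the extactic polynomial is 0, which is the case of
   infinite multiplicity. *)
Definition plane_multiplicity (K : realType) (chi : vfield K) (k : K)
    (m : nat) : Prop :=
  let E := extactic chi [tuple (1 : {mpoly K[3]}); varz] in
  mp_dvd (plane_poly k ^+ m) E /\
  forall m' : nat, mp_dvd (plane_poly k ^+ m') E -> (m' <= m)%N.

(* Planes are counted with multiplicity: s lists the distinct invariant
   parallel planes and mu gives their (finite) multiplicities. *)
Definition has_exactly_invariant_parallel_planes (K : realType)
    (chi : vfield K) (n : nat) : Prop :=
  exists (s : seq K) (mu : K -> nat),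
    [/\ uniq s,
        forall k : K, k \in s <-> invariant_parallel_plane chi k,
        forall k : K, k \in s -> plane_multiplicity chi k (mu k)
      & (\sum_(k <- s) mu k)%N = n].

Definition is_solution (K : realType) (chi : vfield K) (gamma : K -> 'rV[K]_3) :
    Prop :=
  forall t : K,
    is_derive t (1 : K) gamma (\row_i eval_at (tnth chi i) (gamma t)).

(* Equilibria are not periodic orbits. *)
Definition is_periodic_orbit (K : realType) (chi : vfield K)
    (C : set 'rV[K]_3) : Prop :=
  exists (gamma : K -> 'rV[K]_3) (T : K),
    [/\ is_solution chi gamma,
        0 < T,
        forall t : K, gamma (t + T) = gamma t,
        exists t : K, gamma t <> gamma 0
      & range gamma = C].

(* For k = 1 and k = -1, the only values used, this section of the torus is a
   single parallel, the circle x^2 + y^2 = a^2, z = k. *)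
Definition parallel_on (K : realType) (a k : K) : set 'rV[K]_3 :=
  zero_set (torus_poly a) `&` zero_set (plane_poly k).

(* Main.v *)
(** Write w = x^2 + y^2 - a^2, so that the torus is w^2 + z^2 - 1 = 0 and
    invariance reads 4 w (x P + y Q) + 2 z R = L (w^2 + z^2 - 1) with
    deg L <= 2.  Putting z = 0 shows that w divides L(x, y, 0), so
    L(x, y, 0) = c w, and then x = y = 0 gives c (a^4 - 1) = 0, i.e. c = 0.
    Hence L = 2 z N with N affine, R = N (z^2 - 1) + M w with M affine, and
    2 (x P + y Q) = z (N w - M).  Two invariant parallel planes kill M, by
    looking at the part of R of highest degree in x, y on each plane; then
    x = y = 0 leaves N = p x + q y, and what remains is a linear syzygy
    x A + y B = 0, whence A = f y and B = - f x.

    On the circle z = k, k = 1 or -1, the field is g (y, -x, 0) for a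
    polynomial g.  A zero of g is an equilibrium, which a nonconstant solution
    cannot meet by uniqueness (Gronwall).  If g has no zero, it has constant
    sign and the angle satisfies an autonomous scalar equation with positive
    periodic right-hand side, solved by inverting a primitive of 1/g. *)

Require Import Defs.
From HB Require Import structures.
From mathcomp Require Import all_boot all_order all_algebra.
From mathcomp Require Import mpoly.
From mathcomp Require Import boolp classical_sets reals topology normedtype derive.
From mathcomp Require Import functions constructive_ereal sequences realfun exp.
From mathcomp Require Import trigo measure lebesgue_measure lebesgue_integral ftc.
From mathcomp Require Import ring lra zify.

Import Order.TTheory GRing.Theory Num.Theory.
Import numFieldNormedType.Exports.
Local Open Scope classical_set_scope.
Local Open Scope ring_scope.

(** * Substitution, division and degrees of polynomials *)

(** The polynomials with this property contain the variables and are closed under scaling, sums and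
    products; for products, u v - u(t) v(t) = v (u - u(t)) + u(t) (v - v(t)). Serves both for
    division by a linear form and for a Lipschitz bound. *)
Lemma comp_mpoly_subX (R : comNzRingType) (n : nat) (t : n.-tuple {mpoly R[n]})
    (g : {mpoly R[n]}) :
  exists h : 'I_n -> {mpoly R[n]},
    g - (g \mPo t) = \sum_i h i * ('X_i - tnth t i).
Proof.
pose good (g : {mpoly R[n]}) :=
  exists h : 'I_n -> {mpoly R[n]}, g - (g \mPo t) = \sum_i h i * ('X_i - tnth t i).
have good_scale c u : good u -> good (c *: u).
  move=> [h hE]; exists (fun i => c *: h i).
  rewrite comp_mpolyZ -scalerBr hE scaler_sumr.
  by apply: eq_bigr => i _; rewrite scalerAl.
have goodD u v : good u -> good v -> good (u + v).
  move=> [h hE] [k kE]; exists (fun i => h i + k i).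
  rewrite comp_mpolyD opprD addrACA hE kE -big_split /=.
  by apply: eq_bigr => i _; rewrite mulrDl.
have goodM u v : good u -> good v -> good (u * v).
  move=> [h hE] [k kE]; exists (fun i => v * h i + (u \mPo t) * k i).
  rewrite rmorphM /=.
  have -> : u * v - (u \mPo t) * (v \mPo t) =
     v * (u - (u \mPo t)) + (u \mPo t) * (v - (v \mPo t)) by ring.
  rewrite hE kE !mulr_sumr -big_split /=.
  by apply: eq_bigr => i _; rewrite mulrDl !mulrA.
have good1 : good 1.
  exists (fun=> 0); rewrite comp_mpoly1 subrr big1 // => i _; exact: mul0r.
have goodX i : good 'X_i.
  exists (fun j => (j == i)%:R).
  rewrite comp_mpolyXU -tnth_nth (bigD1 i) //= eqxx mul1r big1 ?addr0 //.
  by move=> j /negbTE ->; rewrite mul0r.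
have good0 : good 0 by rewrite -(scale0r 1); exact: good_scale.
rewrite -/(good g); clearbody good.
elim/mpolyind: g => [//|c m u _ _ IH].
apply: goodD IH; apply: good_scale; rewrite mpolyXE_id.
apply: big_ind => // i _; elim: (m i) => [|k IHk]; first by rewrite expr0.
by rewrite exprS; exact: goodM.
Qed.

Definition subst_var (R : nzRingType) (n : nat) (i : 'I_n) (c : R) :
    n.-tuple {mpoly R[n]} :=
  [tuple if j == i then c%:MP else 'X_j | j < n].

Lemma comp_subst_var (R : nzRingType) (n : nat) (i j : 'I_n) (c : R) :
  'X_j \mPo subst_var R n i c = if j == i then c%:MP else 'X_j.
Proof. by rewrite comp_mpolyXU -tnth_nth tnth_mktuple. Qed.

(** Division with remainder by X_i - c: the substitution fixes the other variables, so only the i-th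
    term of the sum survives. *)
Lemma subst_varP (R : comNzRingType) (n : nat) (i : 'I_n) (c : R)
    (g : {mpoly R[n]}) :
  exists h, g = h * ('X_i - c%:MP) + (g \mPo subst_var R n i c).
Proof.
have [h hE] := comp_mpoly_subX R n (subst_var R n i c) g.
exists (h i); apply/eqP; rewrite -subr_eq hE (bigD1 i) //= big1.
  by rewrite addr0 tnth_mktuple eqxx.
by move=> j /negbTE ji; rewrite tnth_mktuple ji subrr mulr0.
Qed.

(** Degrees add over a domain. In terms of degrees: deg v >= j and deg (u v) < i + j give deg u <
    i. *)
Lemma msize_cofactor (R : idomainType) (n i j : nat) (u v : {mpoly R[n]}) :
  (j < msize v)%N -> (msize (u * v) <= i + j)%N -> (msize u <= i)%N.
Proof.
move=> jv; have [->|u0] := eqVneq u 0; first by rewrite msize0.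
have v0 : v != 0 by rewrite -msize_poly_eq0; case: (msize v) jv.
by rewrite msizeM //; move: (msize u) (msize v) jv => k l; lia.
Qed.

Lemma msize_le2E (R : nzRingType) (n : nat) (g : {mpoly R[n]}) :
  (msize g <= 2)%N -> g = (g@_0)%:MP + \sum_i g@_U_(i) *: 'X_i.
Proof.
move=> g2; apply/mpolyP => m.
rewrite mcoeffD mcoeffC raddf_sum /=.
have [m2|] := leqP 2 (mdeg m).
  rewrite (memN_msupp_eq0 (msize_mdeg_ge _)); last exact: leq_trans g2 m2.
  have -> : (m == 0%MM) = false.
    by apply/negbTE; rewrite -mdeg_eq0; case: (mdeg m) m2.
  rewrite mulr0 add0r big1 // => i _; rewrite mcoeffZ mcoeffX.
  case: eqP => [mE|]; last by rewrite mulr0.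
  by move: m2; rewrite -mE mdeg1.
rewrite ltnS leq_eqVlt ltnS leqn0 => /orP[|].
  move=> /mdeg1P[i /eqP ->].
  have -> : (U_(i) == 0 :> 'X_{1..n})%MM = false.
    by apply/negbTE; rewrite -mdeg_eq0 mdeg1.
  rewrite mulr0 add0r (bigD1 i) //= mcoeffZ mcoeffXU eqxx mulr1 big1 ?addr0 //.
  by move=> j /negbTE ji; rewrite mcoeffZ mcoeffXU ji mulr0.
rewrite mdeg_eq0 => /eqP ->; rewrite eqxx mulr1 big1 ?addr0 // => i _.
rewrite mcoeffZ mcoeffX; case: eqP => [mE|]; last by rewrite mulr0.
by have := mdeg1 i; rewrite mE mdeg0.
Qed.

(** Setting X_i to 0 kills the monomials that contain X_i and fixes the others. *)
Lemma msize_comp_subst_var0 (R : comNzRingType) (n : nat) (i : 'I_n)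
    (g : {mpoly R[n]}) :
  (msize (g \mPo subst_var R n i 0) <= msize g)%N.
Proof.
rewrite comp_mpolyEX (leq_trans (msize_sum _ _ _)) //.
apply/bigmax_leqP_seq => m gm _; apply: leq_trans (msize_mdeg_lt gm).
apply: leq_trans (msizeZ_le _ _) _.
rewrite comp_mpolyX; have [mi0|mi0] := eqVneq (m i) 0%N.
  rewrite (_ : \prod_(_ < n) _ = 'X_[m]) ?msizeX //.
  rewrite mpolyXE_id; apply: eq_bigr => j _; rewrite tnth_mktuple.
  by case: eqP => [->|//]; rewrite mi0 !expr0.
by rewrite (bigD1 i) //= tnth_mktuple eqxx expr0n (negbTE mi0) mul0r msize0.
Qed.

(** In degrees: deg u <= i and deg v <= j give deg (u v) <= i + j. The successors absorb the shift
    between [msize] and the degree. *)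
Lemma msizeM_leS (R : idomainType) (n i j : nat) (u v : {mpoly R[n]}) :
  (msize u <= i.+1)%N -> (msize v <= j.+1)%N -> (msize (u * v) <= (i + j).+1)%N.
Proof.
have [->|u0] := eqVneq u 0; first by rewrite mul0r msize0.
have [->|v0] := eqVneq v 0; first by rewrite mulr0 msize0.
by rewrite msizeM //; move: (msize u) (msize v) => k l; lia.
Qed.

Lemma msizeD_leq (R : nzRingType) (n i : nat) (u v : {mpoly R[n]}) :
  (msize u <= i)%N -> (msize v <= i)%N -> (msize (u + v) <= i)%N.
Proof.
by move=> ui vi; rewrite (leq_trans (msizeD_le _ _)) // geq_max ui.
Qed.

(** * Cubic vector fields on the torus *)

Lemma mpoly2_neq0 (K : realType) : (2 : {mpoly K[3]}) != 0.
Proof. by rewrite -mpolyC_nat mpolyC_eq0 pnatr_eq0. Qed.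

Lemma varz_neq0 (K : realType) : (varz : {mpoly K[3]}) != 0.
Proof. by rewrite -msize_poly_eq0 msizeX. Qed.

Lemma vary_neq0 (K : realType) : (vary : {mpoly K[3]}) != 0.
Proof. by rewrite -msize_poly_eq0 msizeX. Qed.

Lemma eval_vec3 (K : realType) (g : {mpoly K[3]}) (r s t : K) :
  eval_at g (vec3 r s t) = g.@[tnth [tuple r; s; t]].
Proof. by apply: meval_eq => i; rewrite mxE. Qed.

Lemma meval_varx (K : realType) (r s t : K) :
  (varx : {mpoly K[3]}).@[tnth [tuple r; s; t]] = r.
Proof. by rewrite mevalXU. Qed.

Lemma meval_vary (K : realType) (r s t : K) :
  (vary : {mpoly K[3]}).@[tnth [tuple r; s; t]] = s.
Proof. by rewrite mevalXU. Qed.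

Lemma meval_varz (K : realType) (r s t : K) :
  (varz : {mpoly K[3]}).@[tnth [tuple r; s; t]] = t.
Proof. by rewrite mevalXU. Qed.

Definition mevalE3 := (mevalD, mevalB, mevalN, mevalM, mevalC, mevalZ, meval1,
  meval0, mevalMn, meval_varx, meval_vary, meval_varz).

Lemma affine_mpoly3 (K : realType) (g : {mpoly K[3]}) :
  (msize g <= 2)%N -> exists c0 c1 c2 c3 : K,
    g = c0%:MP + c1 *: varx + c2 *: vary + c3 *: varz.
Proof.
move=> /msize_le2E ->.
exists g@_0, g@_U_(@Ordinal 3 0 isT), g@_U_(@Ordinal 3 1 isT),
  g@_U_(@Ordinal 3 2 isT).
rewrite !big_ord_recl big_ord0 addr0 !addrA.
by congr (_ + _ *: 'X_ _ + _ *: 'X_ _ + _ *: 'X_ _);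
  try congr (mcoeff U_(_) _); apply/val_inj.
Qed.

Definition cylinder (K : realType) (a : K) : {mpoly K[3]} :=
  varx ^+ 2 + vary ^+ 2 - (a ^+ 2)%:MP.

Lemma torus_polyE (K : realType) (a : K) :
  torus_poly a = cylinder K a ^+ 2 + (varz ^+ 2 - 1).
Proof. by rewrite /torus_poly -addrA. Qed.

(** Were the degree at most 1, r^2 - a^2 would be affine in r on the x-axis; the values at 0, 1 and
    -1 refute this. *)
Lemma msize_cylinder_ge (K : realType) (a : K) : (3 <= msize (cylinder K a))%N.
Proof.
rewrite ltnNge; apply/negP => /affine_mpoly3[c0 [c1 [c2 [c3 cE]]]].
have E r : r ^+ 2 - a ^+ 2 = c0 + c1 * r.
  have /(congr1 (meval (tnth [tuple r; 0; 0]))) := cE.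
  by rewrite /cylinder !(expr2, mevalE3) !(mulr0, addr0) => ->.
have := E 0; have := E 1; have := E (-1); lra.
Qed.

(** The torus polynomial differs from w^2, of degree at least 4, by a polynomial of degree 2. *)
Lemma msize_torus_ge (K : realType) (a : K) : (5 <= msize (torus_poly a))%N.
Proof.
have c3 := msize_cylinder_ge K a.
have c0 : cylinder K a != 0 by rewrite -msize_poly_eq0; case: (msize _) c3.
rewrite leqNgt; apply/negP => F5.
have : (msize (cylinder K a ^+ 2) <= 4)%N.
  have -> : cylinder K a ^+ 2 = torus_poly a + (1 - varz ^+ 2).
    by rewrite torus_polyE; ring.
  apply: leq_trans (msizeD_le _ _) _; rewrite geq_max -ltnS F5 /=.
  apply: leq_trans (msizeD_le _ _) _; rewrite geq_max msize1 mmeasureN /=.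
  by rewrite expr2 msizeM ?varz_neq0 // /varz msizeX mdeg1.
rewrite expr2 msizeM //; move: (msize _) c3 => m. lia.
Qed.

Lemma mpoly_cancel2 (K : realType) (u v : {mpoly K[3]}) : 2 * u = 2 * v -> u = v.
Proof. by apply/mulfI/mpoly2_neq0. Qed.

Lemma cubic_torus_field (K : realType) (a : K) (P Q R L : {mpoly K[3]}) :
  1 < a -> (msize P <= 4)%N -> (msize Q <= 4)%N -> (msize R <= 4)%N ->
  4 * cylinder K a * (varx * P + vary * Q) + 2 * varz * R = L * torus_poly a ->
  exists N M : {mpoly K[3]},
    [/\ (msize N <= 2)%N, (msize M <= 2)%N,
        R = N * (varz ^+ 2 - 1) + M * cylinder K a &
        2 * (varx * P + vary * Q) = varz * (N * cylinder K a - M)].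
Proof.
move=> a1 P4 Q4 R4 E.
have mx : (msize (varx : {mpoly K[3]}) <= 2)%N by rewrite msizeX mdeg1.
have my : (msize (vary : {mpoly K[3]}) <= 2)%N by rewrite msizeX mdeg1.
have mz : (msize (varz : {mpoly K[3]}) <= 2)%N by rewrite msizeX mdeg1.
have mC c : (msize (c%:MP : {mpoly K[3]}) <= 1)%N by rewrite msizeC; case: (_ == _).
have mw : (msize (cylinder K a) <= 3)%N.
  rewrite /cylinder !expr2; apply: msizeD_leq; last by rewrite mmeasureN (leq_trans (mC _)).
  by apply: msizeD_leq; apply: (msizeM_leS _ _ 1%N 1%N).
have w3 := msize_cylinder_ge K a.
have w0 : cylinder K a != 0 by rewrite -msize_poly_eq0; case: (msize _) w3.
have F5 := msize_torus_ge K a.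
(* The left side of [E] has degree at most 6 and the torus polynomial at least 4, so deg L <= 2. *)
have L3 : (msize L <= 3)%N.
  apply: (msize_cofactor _ _ 3%N 4%N _ _ F5); rewrite -E; apply: msizeD_leq.
    apply: (msizeM_leS _ _ 2%N 4%N).
      by apply: (msizeM_leS _ _ 0%N 2%N) => //; rewrite -mpolyC_nat.
    by apply: msizeD_leq; apply: (msizeM_leS _ _ 1%N 3%N).
  apply: (@leq_trans 5) => //; apply: (msizeM_leS _ _ 1%N 3%N) => //.
  by apply: (msizeM_leS _ _ 0%N 1%N) => //; rewrite -mpolyC_nat.
pose iz : 'I_3 := @Ordinal 3 2 isT.
pose at0 (g : {mpoly K[3]}) := g \mPo subst_var K 3 iz 0.
have at0x : at0 varx = varx by rewrite /at0 comp_subst_var.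
have at0y : at0 vary = vary by rewrite /at0 comp_subst_var.
have at0z : at0 varz = 0 by rewrite /at0 comp_subst_var.
have at0C c : at0 c%:MP = c%:MP by rewrite /at0 comp_mpolyC.
have at0n k : at0 k%:R = k%:R by rewrite /at0 rmorph_nat.
have at01 : at0 1 = 1 by rewrite /at0 rmorph1.
have at0D u v : at0 (u + v) = at0 u + at0 v by rewrite /at0 rmorphD.
have at0N u : at0 (- u) = - at0 u by rewrite /at0 rmorphN.
have at0M u v : at0 (u * v) = at0 u * at0 v by rewrite /at0 rmorphM.
have at0w : at0 (cylinder K a) = cylinder K a.
  by rewrite /cylinder !(at0D, expr2, at0N, at0M, at0x, at0y, at0C).
have divz g : exists h, g = h * varz + at0 g.
  by have [h hE] := subst_varP K 3 iz 0 g; exists h; rewrite {1}hE subr0.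
set S := varx * P + vary * Q in E *.
have SE : S = varx * P + vary * Q by [].
have at0_le : (msize (at0 L) <= msize L)%N by exact: msize_comp_subst_var0.
(* From here on, only the morphism rules of z := 0 and the equation [SE] are used. *)
clearbody at0 S.
have S0E : 4 * cylinder K a * at0 S = at0 L * (cylinder K a ^+ 2 - 1).
  have := congr1 at0 E; rewrite torus_polyE.
  rewrite !(expr2, at0w, at0n, at01, at0z, at0N, at0D, at0M) => e.
  have -> : 4 * cylinder K a * at0 S = 4 * cylinder K a * at0 S + 2 * 0 * at0 R.
    by ring.
  by rewrite e; ring.
(* The quotient of L(x, y, 0) by w, read off from [S0E] by isolating the term L(x, y, 0). *)
pose c := at0 L * cylinder K a - 4 * at0 S.
have cE : at0 L = c * cylinder K a.
  have -> : c * cylinder K a = at0 L * cylinder K a ^+ 2 - 4 * cylinder K a * at0 S.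
    by rewrite /c; ring.
  by rewrite S0E; ring.
have c1 : (msize c <= 1)%N.
  apply: (msize_cofactor _ _ 1%N 2%N _ _ w3); rewrite -cE.
  exact: leq_trans at0_le L3.
have S0c : 4 * at0 S = c * (cylinder K a ^+ 2 - 1).
  apply: (mulIf w0); rewrite -mulrA [at0 S * _]mulrC mulrA S0E cE; ring.
(* At the origin S = x P + y Q vanishes and w = -a^2, so c (a^4 - 1) = 0, where a > 1. *)
have c0 : c = 0.
  move: S0c; rewrite (msize1_polyC c1).
  set k := c@_0; rewrite SE at0D !at0M at0x at0y.
  move=> /(congr1 (meval (tnth [tuple 0; 0; 0]))).
  rewrite /cylinder !(expr2, mevalE3) !(mul0r, mulr0, addr0, add0r) mulrNN => e.
  have {}e : k * (a ^+ 4 - 1) = 0 by rewrite e; ring.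
  move/eqP: e; rewrite mulf_eq0 => /orP[/eqP -> //|].
  rewrite subr_eq0 => /eqP a4.
  have a0 : 0 <= a by lra.
  by move: a1; rewrite -(expr_gt1 (isT : 0 < 4)%N a0) a4 ltxx.
have S00 : at0 S = 0.
  by apply: mpoly_cancel2; apply: mpoly_cancel2; rewrite mulrA -natrM S0c c0; ring.
(* Both L and S vanish at z = 0, so L = l z and S = H z, and a factor z cancels from [E]. *)
have [l lE] := divz L; have [H HE] := divz S.
rewrite cE c0 mul0r addr0 in lE; rewrite S00 addr0 in HE.
have lHE : 4 * cylinder K a * H + 2 * R = l * torus_poly a.
  apply: (mulIf (varz_neq0 K)).
  have -> : l * torus_poly a * varz = L * torus_poly a by rewrite lE; ring.
  by rewrite -E HE; ring.
have l2 : (msize l <= 2)%N.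
  apply: (msize_cofactor _ _ 2%N 1%N l varz); last by rewrite -lE.
  by rewrite msizeX mdeg1.
pose N := 2^-1 *: l.
have NE : l = 2 * N.
  by rewrite /N -mpolyC_nat mul_mpolyC scalerA divff ?scale1r // pnatr_eq0.
(* With l = 2 N, the relation reads R = N (w^2 + z^2 - 1) - 2 w H; [M] collects the factor of w. *)
pose M := N * cylinder K a - 2 * H.
have N2 : (msize N <= 2)%N by rewrite (leq_trans (msizeZ_le _ _)).
have RE : R = N * (varz ^+ 2 - 1) + M * cylinder K a.
  apply: mpoly_cancel2.
  have -> : 2 * R = l * torus_poly a - 4 * cylinder K a * H by rewrite -lHE; ring.
  by rewrite NE torus_polyE /M; ring.
exists N, M; split => //.
  apply: (msize_cofactor _ _ 2%N 2%N _ _ w3).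
  have -> : M * cylinder K a = R - N * (varz ^+ 2 - 1) by rewrite {1}RE; ring.
  apply: msizeD_leq => //; rewrite mmeasureN; apply: (msizeM_leS _ _ 1%N 2%N) => //.
  apply: msizeD_leq; first by rewrite expr2; apply: (msizeM_leS _ _ 1%N 1%N).
  by rewrite mmeasureN msize1.
by rewrite HE /M; ring.
Qed.

(** * Action of the field on the plane, torus and extactic polynomials *)

Lemma derivationD (K : realType) (chi : vfield K) (u v : {mpoly K[3]}) :
  derivation chi (u + v) = derivation chi u + derivation chi v.
Proof.
by rewrite /derivation -big_split /=; apply: eq_bigr => i _; rewrite mderivD mulrDr.
Qed.

Lemma derivationM (K : realType) (chi : vfield K) (u v : {mpoly K[3]}) :
  derivation chi (u * v) = derivation chi u * v + u * derivation chi v.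
Proof.
rewrite /derivation mulr_suml mulr_sumr -big_split /=; apply: eq_bigr => i _.
by rewrite mderivM; ring.
Qed.

Lemma derivationC (K : realType) (chi : vfield K) (c : K) :
  derivation chi c%:MP = 0.
Proof. by rewrite /derivation big1 // => i _; rewrite mderivC mulr0. Qed.

Lemma derivationN (K : realType) (chi : vfield K) (u : {mpoly K[3]}) :
  derivation chi (- u) = - derivation chi u.
Proof.
by rewrite /derivation -sumrN; apply: eq_bigr => i _; rewrite mderivN mulrN.
Qed.

Lemma derivationX (K : realType) (chi : vfield K) (i : 'I_3) :
  derivation chi 'X_i = tnth chi i.
Proof.
rewrite /derivation (bigD1 i) //= mderivX mnm1E eqxx scale1r.
rewrite (_ : U_(i) - U_(i) = 0)%MM; last first.
  by apply/mnmP => j; rewrite mnmBE subnn mnm0E.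
rewrite mpolyX0 mulr1 big1 ?addr0 // => j ji.
by rewrite mderivX mnm1E eq_sym (negbTE ji) scale0r mulr0.
Qed.

Lemma derivation_varz (K : realType) (P Q R : {mpoly K[3]}) :
  derivation [tuple P; Q; R] varz = R.
Proof. exact: derivationX. Qed.

Lemma derivation_plane (K : realType) (P Q R : {mpoly K[3]}) (k : K) :
  derivation [tuple P; Q; R] (plane_poly k) = R.
Proof.
by rewrite /plane_poly derivationD derivationN derivationC subr0 derivation_varz.
Qed.

Lemma derivation_torus (K : realType) (a : K) (P Q R : {mpoly K[3]}) :
  derivation [tuple P; Q; R] (torus_poly a) =
  4 * cylinder K a * (varx * P + vary * Q) + 2 * varz * R.
Proof.
rewrite torus_polyE /cylinder !expr2 -[1]/(1%:MP).
rewrite !(derivationD, derivationM, derivationN, derivationC) derivation_varz.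
have -> : derivation [tuple P; Q; R] varx = P by exact: derivationX.
have -> : derivation [tuple P; Q; R] vary = Q by exact: derivationX.
ring.
Qed.

Lemma det_mx22 (R : comNzRingType) (A : 'M[R]_2) :
  \det A = A ord0 ord0 * A ord_max ord_max - A ord0 ord_max * A ord_max ord0.
Proof.
have l0 : lift ord0 ord0 = ord_max :> 'I_2 by apply/val_inj.
have l1 : lift ord_max ord0 = ord0 :> 'I_2 by apply/val_inj.
rewrite (expand_det_row _ ord0) !big_ord_recl big_ord0 addr0 l0.
by rewrite /cofactor !det_mx11 !mxE l0 l1 expr0 expr1 mul1r mulN1r mulrN.
Qed.

Lemma extactic_1z (K : realType) (P Q R : {mpoly K[3]}) :
  extactic [tuple P; Q; R] [tuple 1; varz] = R.
Proof.
rewrite /extactic det_mx22 !mxE.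
have -> : tnth [tuple (1 : {mpoly K[3]}); varz] ord0 = 1 by [].
have -> : tnth [tuple (1 : {mpoly K[3]}); varz] ord_max = varz by [].
have it0 u : iter (ord0 : 'I_2) (derivation [tuple P; Q; R]) u = u by [].
have it1 u : iter (ord_max : 'I_2) (derivation [tuple P; Q; R]) u =
  derivation [tuple P; Q; R] u by [].
rewrite !it0 !it1 derivation_varz [derivation _ 1](derivationC _ _ 1).
by rewrite mul1r mulr0 subr0.
Qed.

(** Either a single plane has multiplicity 2, and k = l, or two distinct planes divide R. R is
    nonzero because the multiplicities are finite and at least one plane occurs. *)
Lemma two_planes_dvd (K : realType) (P Q R : {mpoly K[3]}) :
  has_exactly_invariant_parallel_planes [tuple P; Q; R] 2 ->
  R != 0 /\ exists k l : K, mp_dvd (plane_poly k * plane_poly l) R.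
Proof.
move=> [s [mu [s_uniq s_inv s_mult s_sum]]].
have dvd_plane k : k \in s -> mp_dvd (plane_poly k) R.
  by move=> /s_inv[_ [L]]; rewrite derivation_plane; exists L.
have dvd_mult k : k \in s -> mp_dvd (plane_poly k ^+ mu k) R.
  by move=> /s_mult[]; rewrite extactic_1z.
split.
  apply/eqP => R0; case: s s_sum s_mult {s_uniq s_inv dvd_plane dvd_mult}.
    by rewrite big_nil.
  move=> k s _ /(_ k (mem_head _ _))[_ /(_ (mu k).+1)].
  rewrite ltnn extactic_1z R0 => abs.
  by have /abs : mp_dvd (plane_poly k ^+ (mu k).+1) 0 by exists 0; rewrite mul0r.
case: s s_uniq s_sum dvd_plane dvd_mult {s_inv s_mult} => [|k [|l s]].
- by rewrite big_nil.
- rewrite big_seq1 => _ mu2 _ /(_ k (mem_head _ _)); rewrite mu2 expr2.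
  by exists k, k.
rewrite /= inE negb_or => /andP[/andP[kl _] _] _ dvd_plane _.
have /dvd_plane[u uE] : k \in [:: k, l & s] by rewrite inE eqxx.
have /dvd_plane[v vE] : l \in [:: k, l & s] by rewrite !inE eqxx orbT.
(* From R = u (z - k) = v (z - l) follows (v - u) (z - k) (z - l) = R (z - k) - R (z - l) = (l - k)
   R. *)
exists k, l, ((l - k)^-1 *: (v - u)).
have lk0 : l - k != 0 by rewrite subr_eq0 eq_sym.
rewrite -scalerAl.
have -> : (v - u) * (plane_poly k * plane_poly l) =
    R * plane_poly k - R * plane_poly l by rewrite {1}vE {1}uE; ring.
have -> : R * plane_poly k - R * plane_poly l = (l - k) *: R.
  by rewrite -mul_mpolyC mpolyCB /plane_poly; ring.
by rewrite scalerA mulVf // scale1r.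
Qed.

(** * Normal form of a field with two invariant parallel planes *)

Lemma msize_degree (K : realType) (chi : vfield K) (i : 'I_3) (n : nat) :
  (vf_degree chi <= n)%N -> (msize (tnth chi i) <= n.+1)%N.
Proof.
move=> /bigmax_leqP/(_ i isT); rewrite /degree; move: (msize _) => m; lia.
Qed.

(** At y = 0 the relation becomes x A(x, 0, z) = 0, so y divides A; cancelling y then gives B. *)
Lemma linear_syzygy (K : realType) (A B : {mpoly K[3]}) :
  varx * A + vary * B = 0 -> exists f, A = f * vary /\ B = - (f * varx).
Proof.
move=> AB0.
pose iy : 'I_3 := @Ordinal 3 1 isT.
have [f fE] := subst_varP K 3 iy 0 A.
exists f; have A0 : A \mPo subst_var K 3 iy 0 = 0.
  have := congr1 (comp_mpoly (subst_var K 3 iy 0)) AB0.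
  rewrite rmorphD !rmorphM /= !comp_subst_var /= mul0r addr0 comp_mpoly0.
  by move/eqP; rewrite mulf_eq0 -msize_poly_eq0 msizeX => /eqP.
have AE : A = f * vary by rewrite fE A0 subr0 addr0.
split=> //; apply: (mulfI (vary_neq0 K)).
by apply/eqP; rewrite -subr_eq0 -AB0 AE; apply/eqP; ring.
Qed.

(** A cubic in r with four zeros is 0, and its coefficients of r^2 and r^3 are [m0] and [m1]. *)
Lemma cubic_vanishing_diagonal (K : realType) (a n0 n1 m0 m1 : K) :
  (forall r, n0 + n1 * r + (m0 + m1 * r) * (r ^+ 2 - a) = 0) ->
  m0 = 0 /\ m1 = 0.
Proof.
move=> E; have := E 0; have := E 1; have := E (-1); have := E 2.
by split; lra.
Qed.

(** The right side vanishes on z = k and z = l. Restricting to the lines y = 0 and x = 0 of such a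
    plane z = t gives cubics whose top coefficients are those of M there. This kills [m1], [m2] and
    [m0 + m3 * t], and leaves only [m3]. *)
Lemma parallel_cofactor_eq0 (K : realType) (a k l : K) (N M q : {mpoly K[3]}) :
  (msize N <= 2)%N -> (msize M <= 2)%N ->
  N * (varz ^+ 2 - 1) + M * cylinder K a = q * (plane_poly k * plane_poly l) ->
  M = 0.
Proof.
move=> /affine_mpoly3[n0 [n1 [n2 [n3 ->]]]] /affine_mpoly3[m0 [m1 [m2 [m3 ->]]]] E.
have ev r s t := congr1 (meval (tnth [tuple r; s; t])) E.
rewrite /cylinder /plane_poly in ev.
have onplane t : t = k \/ t = l -> [/\ m1 = 0, m2 = 0 & m0 + m3 * t = 0].
  move=> tkl.
  have E0 r s : (n0 + n1 * r + n2 * s + n3 * t) * (t ^+ 2 - 1) +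
      (m0 + m1 * r + m2 * s + m3 * t) * (r ^+ 2 + s ^+ 2 - a ^+ 2) = 0.
    have := ev r s t; rewrite !(expr2, mevalE3) => ->.
    by case: tkl => ->; rewrite subrr ?(mul0r, mulr0).
  have [|e1 e2] := @cubic_vanishing_diagonal K (a ^+ 2) ((n0 + n3 * t) * (t ^+ 2 - 1))
      (n1 * (t ^+ 2 - 1)) (m0 + m3 * t) m1.
    by move=> r; rewrite -[RHS](E0 r 0); ring.
  have [|_ e3] := @cubic_vanishing_diagonal K (a ^+ 2) ((n0 + n3 * t) * (t ^+ 2 - 1))
      (n2 * (t ^+ 2 - 1)) (m0 + m3 * t) m2.
    by move=> r; rewrite -[RHS](E0 0 r); ring.
  by [].
have [m10 m20 mk] := onplane k (or_introl erefl).
have [_ _ ml] := onplane l (or_intror erefl).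
suff m30 : m3 = 0.
  have m00 : m0 = 0 by rewrite -mk m30; ring.
  by rewrite m10 m20 m30 m00 !scale0r !addr0.
have [kl|kl] := eqVneq k l; last first.
  apply/eqP; have : m3 * (k - l) == 0.
    by rewrite -(subr0 0) -{1}mk -{1}ml; apply/eqP; ring.
  by rewrite mulf_eq0 subr_eq0 (negbTE kl) orbF.
(* For a double plane k = l the z-derivative of the right side vanishes on z = k as well; the
   coefficient of r^2 in that of the left side is [m3]. *)
pose dz := derivation [tuple 0; 0; 1 : {mpoly K[3]}].
have dzx : dz varx = 0 by exact: derivationX.
have dzy : dz vary = 0 by exact: derivationX.
have dzz : dz varz = 1 by exact: derivationX.
have dE := (derivationD, derivationN, derivationM, derivationC).
have := congr1 dz E; rewrite /cylinder /plane_poly -!mul_mpolyC !expr2 /dz.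
rewrite !dE -/dz dzx dzy dzz => Ed.
have E0 r : (n0 + n1 * r + n3 * k) * (2 * k) + n3 * (k ^+ 2 - 1) +
      m3 * (r ^+ 2 - a ^+ 2) = 0.
  have := congr1 (meval (tnth [tuple r; 0; k])) Ed.
  rewrite -kl m10 m20 !(mevalE3) !(subrr, mul0r, mulr0, addr0, add0r, mulr1, mul1r, oppr0).
  by move=> <-; ring.
by have [] := @cubic_vanishing_diagonal K (a ^+ 2) ((n0 + n3 * k) * (2 * k) + n3 * (k ^+ 2 - 1))
      (n1 * (2 * k)) m3 0 _ => // r; rewrite -[RHS](E0 r); ring.
Qed.

Lemma torus_field_two_planes (K : realType) (a : K) (P Q R : {mpoly K[3]}) (k l : K) :
  1 < a -> (msize P <= 4)%N -> (msize Q <= 4)%N -> (msize R <= 4)%N ->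
  invariant_surface [tuple P; Q; R] (torus_poly a) ->
  mp_dvd (plane_poly k * plane_poly l) R ->
  exists (f : {mpoly K[3]}) (p q : K),
    [/\ (degree f <= 2)%N,
    P = 2^-1 *: (varx * varz * (p *: varx + q *: vary)) + f * vary
        - (a ^+ 2 * p / 2) *: varz,
    Q = 2^-1 *: (vary * varz * (p *: varx + q *: vary)) - f * varx
        - (a ^+ 2 * q / 2) *: varz &
    R = (p *: varx + q *: vary) * (varz ^+ 2 - 1)].
Proof.
move=> a1 P4 Q4 R4 [L]; rewrite derivation_torus => LE [g gE].
have [N [M [N2 M2 RE SE]]] := cubic_torus_field _ _ _ _ _ _ a1 P4 Q4 R4 LE.
have M0 : M = 0.
  by apply: (@parallel_cofactor_eq0 K a k l N M g) => //; rewrite -RE.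
rewrite M0 mul0r addr0 in RE; rewrite M0 subr0 in SE.
have [n0 [p [q [n3 NE]]]] := affine_mpoly3 _ _ N2.
(* On the z-axis x P + y Q = 0 and w = -a^2 is nonzero, so z N vanishes there. *)
have ev t : t * (n0 + n3 * t) = 0.
  have := congr1 (meval (tnth [tuple 0; 0; t])) SE.
  rewrite NE /cylinder !(expr2, mevalE3) !(mul0r, mulr0, addr0, add0r) => e.
  have : t * (n0 + n3 * t) * a ^+ 2 = 0 by rewrite -[RHS]oppr0 e; ring.
  move/eqP; rewrite mulf_eq0 expf_eq0 /= => /orP[/eqP //|/eqP a0].
  by move: a1; rewrite a0; lra.
have n00 : n0 = 0 by have := ev 1; have := ev (-1); lra.
have n30 : n3 = 0 by have := ev 1; have := ev (-1); lra.
have {}NE : N = p *: varx + q *: vary by rewrite NE n00 n30 scale0r addr0 add0r.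
(* [A] and [B] are what remains of P and Q after subtracting a particular solution of 2 (x P + y Q)
   = z N w. *)
pose A := P - 2^-1 *: (varx * varz * N) + (a ^+ 2 * p / 2) *: varz.
pose B := Q - 2^-1 *: (vary * varz * N) + (a ^+ 2 * q / 2) *: varz.
have half (u : {mpoly K[3]}) : 2 * (2^-1 *: u) = u.
  by rewrite -mpolyC_nat mul_mpolyC scalerA divff ?scale1r // pnatr_eq0.
have AB0 : varx * A + vary * B = 0.
  apply: mpoly_cancel2; rewrite mulr0 /A /B.
  rewrite ![_ / 2]mulrC -![(2^-1 * _) *: _]scalerA.
  set uP := varx * varz * N; set uQ := vary * varz * N.
  set vp := (_ * p) *: varz; set vq := (_ * q) *: varz.
  have -> : 2 * (varx * (P - 2^-1 *: uP + 2^-1 *: vp) +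
      vary * (Q - 2^-1 *: uQ + 2^-1 *: vq)) =
    2 * (varx * P + vary * Q) - varx * (2 * (2^-1 *: uP) - 2 * (2^-1 *: vp))
      - vary * (2 * (2^-1 *: uQ) - 2 * (2^-1 *: vq)) by ring.
  rewrite !half SE /uP /uQ /vp /vq NE /cylinder -!mul_mpolyC !mpolyCM.
  ring.
have [f [fA fB]] := linear_syzygy _ _ _ AB0.
have PE : P = 2^-1 *: (varx * varz * N) + f * vary - (a ^+ 2 * p / 2) *: varz.
  by rewrite -fA /A; ring.
have QE : Q = 2^-1 *: (vary * varz * N) - f * varx - (a ^+ 2 * q / 2) *: varz.
  by rewrite -fB /B; ring.
rewrite NE in PE QE RE; exists f, p, q; split=> //.
have mx : (msize (varx : {mpoly K[3]}) <= 2)%N by rewrite msizeX mdeg1.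
have mz : (msize (varz : {mpoly K[3]}) <= 2)%N by rewrite msizeX mdeg1.
(* The product f y = A has degree at most 3. *)
have f3 : (msize f <= 3)%N.
  apply: (msize_cofactor _ _ 3%N 1%N f vary); first by rewrite msizeX mdeg1.
  rewrite -fA; apply: msizeD_leq.
    apply: msizeD_leq; first by [].
    rewrite mmeasureN (leq_trans (msizeZ_le _ _)) //.
    by apply: (msizeM_leS _ _ 2%N 1%N) => //; apply: (msizeM_leS _ _ 1%N 1%N).
  by rewrite (leq_trans (msizeZ_le _ _)) // (leq_trans mz).
by rewrite /degree; case: (msize f) f3.
Qed.

(** Invariance of z = k means that z - k divides R. Since R is nonzero, p or q is, and evaluation at
    (1, 0, k) and (0, 1, k) forces k^2 = 1. *)
Lemma invariant_parallel_plane_iff (K : realType) (p q k : K)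
    (P Q R : {mpoly K[3]}) : R != 0 ->
  R = (p *: varx + q *: vary) * (varz ^+ 2 - 1) ->
  invariant_parallel_plane [tuple P; Q; R] k <-> k = 1 \/ k = -1.
Proof.
move=> R0 RE; split; last first.
  move=> k1; split; first by case: k1 => ->; lra.
  exists ((p *: varx + q *: vary) * (varz + k%:MP)).
  rewrite derivation_plane RE /plane_poly.
  have -> : 1 = k%:MP * k%:MP :> {mpoly K[3]}.
    by rewrite -mpolyCM; case: k1 => ->; rewrite ?mulrNN mulr1.
  by ring.
move=> [_ [L]]; rewrite derivation_plane => LE.
have E r s : (p * r + q * s) * (k ^+ 2 - 1) = 0.
  have := congr1 (meval (tnth [tuple r; s; k])) LE.
  by rewrite RE /plane_poly !(expr2, mevalE3) subrr mulr0.
have : k ^+ 2 - 1 == 0.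
  have := E 1 0; have := E 0 1; rewrite !(mulr0, mulr1, addr0, add0r).
  move=> /eqP; rewrite mulf_eq0 => /orP[/eqP q0|-> //].
  move=> /eqP; rewrite mulf_eq0 => /orP[/eqP p0|-> //].
  by move: R0; rewrite RE p0 q0 !scale0r addr0 mul0r eqxx.
by rewrite subr_eq0 sqrf_eq1 => /orP[/eqP|/eqP]; [left|right].
Qed.

(** * Gronwall's inequality and flows on the circle *)

Lemma is_derive_continuous (K : realType) (f df : K -> K) :
  (forall x, is_derive x (1 : K) f (df x)) -> continuous f.
Proof.
move=> fd x.
exact/differentiable_continuous/derivable1_diffP/(@ex_derive _ _ _ _ _ _ _ (fd x)).
Qed.

Lemma is_derive_le0_nincr (K : realType) (f df : K -> K) :
  (forall x, is_derive x (1 : K) f (df x)) -> (forall x, df x <= 0) ->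
  forall x y, x <= y -> f y <= f x.
Proof.
move=> fd df0 x y xy.
have [|z _ fxy] := @MVT_segment K f df x y xy.
  by apply: continuous_subspaceT; exact: is_derive_continuous fd.
by rewrite -subr_le0 fxy mulr_le0_ge0 // subr_ge0.
Qed.

Lemma is_derive_gt0_incr (K : realType) (f df : K -> K) :
  (forall x, is_derive x (1 : K) f (df x)) -> (forall x, 0 < df x) ->
  forall x y, x < y -> f x < f y.
Proof.
move=> fd df0 x y xy.
have [|z _ fxy] := @MVT K f df x y xy.
  by apply: continuous_subspaceT; exact: is_derive_continuous fd.
by rewrite -subr_gt0 fxy mulr_gt0 // subr_gt0.
Qed.

(** After [t0], the function u exp(-C t) is nonincreasing from 0; before [t0], u exp(C t) is
    nondecreasing up to 0. As u >= 0, it vanishes on both sides. *)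
Lemma gronwall_zero (K : realType) (u du : K -> K) (C t0 : K) :
  (forall t, is_derive t (1 : K) u (du t)) ->
  (forall t, 0 <= u t) -> (forall t, `|du t| <= C * u t) -> u t0 = 0 ->
  forall t, u t = 0.
Proof.
move=> ud u0 duC ut0 t.
have duN s : du s <= C * u s by exact: le_trans (ler_norm _) (duC s).
have duP s : - (C * u s) <= du s by rewrite lerNl (le_trans _ (duC s)) // -normrN ler_norm.
have decr s : is_derive s (1 : K) (fun s => u s * expR (- (C * s)))
    ((du s - C * u s) * expR (- (C * s))).
  by apply: is_derive_eq; rewrite /GRing.scale /=; ring.
have incr s : is_derive s (1 : K) (fun s => - (u s * expR (C * s)))
    (- ((du s + C * u s) * expR (C * s))).
  by apply: is_derive_eq; rewrite /GRing.scale /=; ring.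
apply/eqP; rewrite eq_le u0 andbT.
have [t0t|/ltW tt0] := leP t0 t.
  have := is_derive_le0_nincr _ _ _ decr _ _ _ t0t.
  rewrite ut0 mul0r pmulr_lle0 ?expR_gt0 //; apply => s.
  by rewrite mulr_le0_ge0 ?expR_ge0 // subr_le0.
have := is_derive_le0_nincr _ _ _ incr _ _ _ tt0.
rewrite ut0 mul0r oppr0 oppr_ge0 pmulr_lle0 ?expR_gt0 //; apply => s.
by rewrite oppr_le0 mulr_ge0 ?expR_ge0 // -lerBlDr sub0r.
Qed.

(** The bound is the polynomial with coefficients in absolute value, evaluated at (r, ..., r). *)
Lemma meval_bounded (K : realType) (n : nat) (g : {mpoly K[n]}) (r : K) :
  exists B, forall v : 'I_n -> K, (forall i, `|v i| <= r) -> `|g.@[v]| <= B.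
Proof.
exists (\sum_(m <- msupp g) `|g@_m| * \prod_i r ^+ m i) => v vr.
rewrite mevalE (le_trans (ler_norm_sum _ _ _)) // ler_sum // => m _.
rewrite normrM ler_wpM2l // normr_prod ler_prod // => i _.
by rewrite normr_ge0 normrX lerXn2r // nnegrE ?normr_ge0 // (le_trans _ (vr i)).
Qed.

(** The primitive is the oriented integral from 0. Near x it equals G - G(0), where G integrates
    from a point b to the left of both 0 and x, so the fundamental theorem applies to G. *)
Lemma two_sided_primitive (K : realType) (c : K -> K) :
  continuous c -> exists F : K -> K, forall x, is_derive x (1 : K) F (c x).
Proof.
move=> cc; pose mu := @lebesgue_measure K.
have ci x y : mu.-integrable `[x, y] (EFin \o c).
  apply: continuous_compact_integrable; first exact: segment_compact.
  exact: continuous_subspaceT.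
pose F x := if 0 <= x then \int[mu]_(t in `[0, x]) c t
            else - \int[mu]_(t in `[x, 0]) c t.
exists F => x.
pose b := - (`|x| + 1); pose G y := \int[mu]_(t in `[b, y]) c t.
have b0 : b <= 0 by rewrite oppr_le0 addr_ge0.
have bx : b < x by rewrite ltrNl (@le_lt_trans _ _ `|x|) ?ltrDl // -normrN ler_norm.
have [dG G'] := continuous_FTC1_closed (ltr_pwDr ltr01 (lexx x)) (ci b _) bx (cc x).
have split_int y z : b <= y -> y <= z -> G z - G y = \int[mu]_(t in `[y, z]) c t.
  move=> hby yz; rewrite /G Rintegral_itvB ?bnd_simp //.
  apply: Rintegral_itv_obnd_cbnd; apply: integrableS (ci y z) => //.
  by apply: subset_itvr; rewrite bnd_simp.
have FG : \near x, G x - G 0 = F x.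
  near=> y; have yb : b <= y by apply: ltW; near: y; exact: lt_nbhsr.
  rewrite /F; case: ifPn => y0; first exact: split_int.
  by rewrite -[LHS]opprB split_int // ltW // ltNge.
apply: near_eq_is_derive FG _.
have Gd : is_derive x (1 : K) G (c x) by apply: DeriveDef => //; rewrite -derive1E.
by apply: is_derive_eq; rewrite subr0.
Unshelve. all: by end_near. Qed.

(** Separation of variables: [tau], the primitive of 1/w with value 0 at 0, is the time needed to
    reach an angle, and [theta] is its inverse. The period T = [tau p] is the time of one full
    turn. *)
Lemma periodic_flow (K : realType) (w : K -> K) (p : K) :
  0 < p -> continuous w -> (forall x, 0 < w x) -> (forall x, w (x + p) = w x) ->
  exists (theta : K -> K) (T : K),
    [/\ 0 < T, forall t, is_derive t (1 : K) theta (w (theta t)),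
        forall t, theta (t + T) = theta t + p & forall x, exists t, theta t = x].
Proof.
move=> p0 wc w0 wp.
have wVc : continuous (fun x => (w x)^-1).
  by move=> x; apply: cvgV; [rewrite gt_eqF|exact: wc].
have [F0 F0d] := two_sided_primitive _ _ wVc.
have wV0 x : 0 < (w x)^-1 by rewrite invr_gt0.
pose tau x := F0 x - F0 0.
have taud x : is_derive x (1 : K) tau (w x)^-1.
  by apply: is_derive_eq; rewrite subr0.
have tau0 : tau 0 = 0 by rewrite /tau subrr.
clearbody tau.
have tau_incr := is_derive_gt0_incr _ _ _ taud wV0.
have tau_cont := is_derive_continuous _ _ _ taud.
pose T := tau p.
have T0 : 0 < T by rewrite /T -tau0; exact: tau_incr.
have tauD x : tau (x + p) = tau x + T.
  have shiftd y : is_derive y (1 : K) (fun y => tau (y + p)) (w y)^-1.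
    have sd : is_derive y (1 : K) (fun y => y + p) 1.
      by apply: is_derive_eq; rewrite addr0.
    have := @is_derive1_comp K tau (fun y => y + p) y _ 1 (taud (y + p)) sd.
    by rewrite wp mulr1.
  (* By periodicity of w this difference has derivative 0, hence is constant. *)
  pose D y := tau (y + p) - tau y.
  have : D x = D 0.
    by apply: (@is_derive_0_is_cst K D) => y; apply: is_derive_eq; rewrite subrr.
  by rewrite /D add0r tau0 subr0 -/T => <-; rewrite [RHS]addrC subrK.
clearbody T.
have tauDn n x : tau (x + p *+ n) = tau x + T *+ n.
  elim: n => [|n IH]; first by rewrite !mulr0n !addr0.
  by rewrite !mulrSr !addrA tauD IH.
(* As [tau] takes the values -nT and nT at -np and np, intermediate values reach every t with |t| <=
   nT. *)
have tau_surj t : exists x, tau x = t.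
  pose n := (Num.truncn (`|t| / T)).+1.
  have tn : `|t| <= T *+ n.
    rewrite -mulr_natr -ler_pdivrMl // mulrC ltW //.
    by rewrite /n real_truncnS_gt // num_real.
  have : - (T *+ n) <= t <= T *+ n by rewrite -ler_norml.
  have taun : tau (p *+ n) = T *+ n by rewrite -[p *+ n]add0r tauDn tau0 add0r.
  have tauNn : tau (- (p *+ n)) = - (T *+ n).
    by apply/eqP; rewrite -subr_eq0 opprK -tauDn addNr tau0.
  move=> tb; have [|||x _ <-] := @IVT K tau (- (p *+ n)) (p *+ n) t.
  - by rewrite lerNl (le_trans _ (mulrn_wge0 _ (ltW p0))) // oppr_le0 mulrn_wge0 // ltW.
  - exact: continuous_subspaceT.
  - by rewrite taun tauNn; case/andP: tb => h1 h2; rewrite ge_min le_max h1 h2 orbT.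
  by exists x.
pose theta t := sval (cid (tau_surj t)).
have thetaK t : tau (theta t) = t by exact: svalP (cid (tau_surj t)).
have tau_inj x y : tau x = tau y -> x = y.
  by move=> e; case: (ltgtP x y) => // /tau_incr; rewrite e ltxx.
have tauK x : theta (tau x) = x by apply: tau_inj; rewrite thetaK.
exists theta, T; split => //.
- move=> t; rewrite -{1}(thetaK t) -[w _]invrK.
  apply: is_derive_inverse.
  + by near=> y; exact: tauK.
  + by near=> y; exact: tau_cont.
  + by rewrite gt_eqF.
- by move=> t; apply: tau_inj; rewrite thetaK tauD thetaK.
by move=> x; exists (tau x).
Unshelve. all: by end_near. Qed.

Lemma continuous_neq0_sign (K : realType) (g : K -> K) :
  continuous g -> (forall x, g x != 0) ->
  (forall x, 0 < g x) \/ (forall x, g x < 0).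
Proof.
move=> gc g0.
suff same x y : 0 < g x -> 0 < g y.
  case: (ltgtP 0 (g 0)) => [g00|g00|/eqP]; last by rewrite eq_sym (negbTE (g0 0)).
    by left=> x; exact: (same 0).
  right=> x; rewrite ltNge le_eqVlt eq_sym (negbTE (g0 x)) /=.
  by apply/negP => /(same x 0); rewrite ltNge (ltW g00).
move=> gx; rewrite ltNge; apply/negP => gy.
(* Reflecting the argument, z to -z, exchanges the order of x and y and keeps the signs of the
   values. *)
wlog xy : g x y gc g0 gx gy / x <= y.
  move=> W; have [/W|/ltW yx] := leP x y; first exact.
  apply: (W (fun z => g (- z)) (- x) (- y)); rewrite ?opprK ?lerN2 // => z.
  by apply: (@cvg_comp _ _ _ -%R g _ (nbhs (- z))); [exact: cvgN|exact: gc].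
have [||z _ gz] := @IVT K g x y 0 xy.
- exact: continuous_subspaceT.
- by rewrite ge_min le_max gy (ltW gx) orbT.
by have := g0 z; rewrite gz eqxx.
Qed.

(** The angle is acos(x/a), negated when y < 0. *)
Lemma circle_param (K : realType) (a x y : K) : 0 < a ->
  x ^+ 2 + y ^+ 2 = a ^+ 2 -> exists t, x = a * cos t /\ y = a * sin t.
Proof.
move=> a0 xya; have an0 : a != 0 by rewrite gt_eqF.
pose c := x / a.
have xE : x = a * c by rewrite /c mulrC divfK.
have yE : y ^+ 2 = a ^+ 2 * (1 - c ^+ 2).
  by rewrite mulrBr mulr1 -exprMn -xE -xya addrC addKr.
have c1 : -1 <= c <= 1.
  rewrite -ler_norml -(@expr_le1 _ 2) // -normrX ger0_norm ?sqr_ge0 // -subr_ge0.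
  by rewrite -(pmulr_rge0 _ (exprn_gt0 2 a0)) -yE sqr_ge0.
have sE : a * Num.sqrt (1 - c ^+ 2) = `|y|.
  by rewrite -sqrtr_sqr yE sqrtrM ?sqr_ge0 // sqrtr_sqr gtr0_norm.
have cosE : cos (acos c) = c by rewrite acosK.
have [y0|y0] := leP 0 y.
  by exists (acos c); rewrite cosE sin_acos // sE ger0_norm.
exists (- acos c); rewrite cosN sinN cosE sin_acos // mulrN sE ltr0_norm //.
by rewrite opprK.
Qed.

(** Substituting the constants [v0] gives g - g(v0) as a combination of the X_i - v0_i, with
    coefficients bounded on the box. *)
Lemma meval_lipschitz (K : realType) (n : nat) (g : {mpoly K[n]})
    (v0 : 'I_n -> K) (r : K) :
  exists2 C, 0 <= C & forall v : 'I_n -> K, (forall i, `|v i| <= r) ->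
    `|g.@[v] - g.@[v0]| <= C * \sum_i `|v i - v0 i|.
Proof.
have [h hE] := comp_mpoly_subX K n [tuple (v0 i)%:MP | i < n] g.
have [B hB] := fin_all_exists (fun i => meval_bounded K n (h i) r).
exists (\sum_i `|B i|) => [|v vr]; first by apply: sumr_ge0.
have -> : g.@[v] - g.@[v0] = \sum_i (h i).@[v] * (v i - v0 i).
  have := congr1 (meval v) hE; rewrite mevalB comp_mpoly_meval.
  have -> : g.@[fun i => (tnth [tuple (v0 j)%:MP | j < n] i).@[v]] = g.@[v0].
    by apply: meval_eq => i; rewrite tnth_mktuple mevalC.
  move=> ->; rewrite [LHS](raddf_sum (meval v)).
  apply: eq_bigr => i _; rewrite tnth_mktuple.
  rewrite -[LHS]/((h i * ('X_i - (v0 i)%:MP)).@[v]).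
  by rewrite mevalM mevalB mevalXU mevalC.
rewrite mulr_sumr (le_trans (ler_norm_sum _ _ _)) // ler_sum // => i _.
rewrite normrM ler_wpM2r // (le_trans (hB i v vr)) //.
rewrite (bigD1 i) //= (le_trans (ler_norm _)) // lerDl.
by apply: sumr_ge0.
Qed.

Lemma continuous_meval (K : realType) (n : nat) (g : {mpoly K[n]})
    (v : K -> 'I_n -> K) :
  (forall i, continuous (fun t => v t i)) -> continuous (fun t => g.@[v t]).
Proof.
move=> vc; pose good (g : {mpoly K[n]}) := continuous (fun t => g.@[v t]).
have good_cst c : good c%:MP.
  rewrite /good (_ : (fun _ => _) = fun=> c); first exact: cst_continuous.
  by apply/funext => t; rewrite mevalC.
have good1 : good 1 := good_cst 1.
have goodM u w : good u -> good w -> good (u * w).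
  move=> uc wc; rewrite /good (_ : (fun _ => _) = fun t => u.@[v t] * w.@[v t]).
    by move=> t; apply: cvgM; [exact: uc|exact: wc].
  by apply/funext => t; rewrite mevalM.
have goodD u w : good u -> good w -> good (u + w).
  move=> uc wc; rewrite /good (_ : (fun _ => _) = fun t => u.@[v t] + w.@[v t]).
    by move=> t; apply: cvgD; [exact: uc|exact: wc].
  by apply/funext => t; rewrite mevalD.
have goodX i : good 'X_i.
  rewrite /good (_ : (fun _ => _) = fun t => v t i); first exact: vc.
  by apply/funext => t; rewrite mevalXU.
rewrite -/(good g); clearbody good.
elim/mpolyind: g => [|c m u _ _ IH]; first by rewrite -mpolyC0.
apply: goodD IH; rewrite -mul_mpolyC mpolyXE_id; apply: (goodM _ _ (good_cst c)).
apply: big_ind => // i _; elim: (m i) => [|k IHk]; first by rewrite expr0.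
by rewrite exprS; exact: goodM.
Qed.

(** * Uniqueness of solutions at an equilibrium *)

Lemma is_solutionP (K : realType) (chi : vfield K) (gamma : K -> 'rV[K]_3) :
  is_solution chi gamma <-> forall t i,
    is_derive t (1 : K) (fun s => gamma s ord0 i) (eval_at (tnth chi i) (gamma t)).
Proof.
split=> [sol t i|sol t].
  have [gd gD] := sol t; apply: DeriveDef.
    by have /derivable_mxP := gd; apply.
  by move/matrixP: gD => /(_ ord0 i); rewrite derive_mx // !mxE.
have gd : derivable gamma t 1.
  by apply/derivable_mxP => i j; rewrite ord1; have [] := sol t j.
apply: DeriveDef => //; apply/matrixP => i j.
by rewrite derive_mx // !mxE ord1; have [] := sol t j.
Qed.

(** The squared distance u to the equilibrium satisfies |u'| <= C u, because the field vanishes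
    there and satisfies a Lipschitz bound at it on the box containing the solution; Gronwall gives u
    = 0. *)
Lemma bounded_solution_equilibrium (K : realType) (chi : vfield K)
    (gamma : K -> 'rV[K]_3) (r t0 : K) :
  is_solution chi gamma -> (forall t i, `|gamma t ord0 i| <= r) ->
  (forall i, eval_at (tnth chi i) (gamma t0) = 0) ->
  forall t, gamma t = gamma t0.
Proof.
move=> /is_solutionP sol gr eq0.
pose d t i := gamma t ord0 i - gamma t0 ord0 i.
pose u t := \sum_i d t i ^+ 2.
pose du t := \sum_i 2 * d t i * eval_at (tnth chi i) (gamma t).
have [C C0 hC] := fin_all_exists2 (fun i =>
  meval_lipschitz K 3 (tnth chi i) (fun j => gamma t0 ord0 j) r).
have ud t : is_derive t (1 : K) u (du t).
  rewrite /u /du; have dd i : is_derive t (1 : K) (fun t => d t i ^+ 2)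
      (2 * d t i * eval_at (tnth chi i) (gamma t)).
    have := sol t i; rewrite /d => sol_i; apply: is_derive_eq.
    by rewrite /GRing.scale /=; ring.
  rewrite (_ : (fun _ => _) = \sum_i (fun t => d t i ^+ 2)); last first.
    by apply/funext => s; rewrite fct_sumE.
  exact: is_derive_sum.
have u0 t : 0 <= u t by apply: sumr_ge0 => i _; exact: sqr_ge0.
(* The 6 is 2 from differentiating squares times 3 from (|d_0| + |d_1| + |d_2|)^2 <= 3 u. *)
have duC t : `|du t| <= (6 * \sum_i C i) * u t.
  pose F i := eval_at (tnth chi i) (gamma t).
  pose A := \sum_j `|d t j|.
  have Fle i : `|F i| <= (\sum_i C i) * A.
    have := hC i (fun j => gamma t ord0 j) (gr t).
    rewrite -/(eval_at _ (gamma t)) -/(eval_at _ (gamma t0)) eq0 subr0 => h.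
    apply: le_trans h _; rewrite ler_wpM2r //; first by apply: sumr_ge0.
    rewrite (bigD1 i) //= lerDl; apply: sumr_ge0 => j _.
    exact: C0.
  have Csum0 : 0 <= \sum_i C i by apply: sumr_ge0 => j _; exact: C0.
  have du_le : `|du t| <= 2 * (\sum_i C i) * A ^+ 2.
    rewrite (le_trans (ler_norm_sum _ _ _)) //.
    apply: (@le_trans _ _ (\sum_i 2 * `|d t i| * ((\sum_i C i) * A))).
      apply: ler_sum => i _; rewrite !normrM (ger0_norm (_ : 0 <= 2)) //.
      by rewrite ler_wpM2l ?mulr_ge0 ?Fle.
    by rewrite -mulr_suml -mulr_sumr -/A le_eqVlt; apply/orP; left; apply/eqP; ring.
  rewrite (le_trans du_le) //.
  have -> : 6 * (\sum_i C i) * u t = 2 * (\sum_i C i) * (3 * u t) by ring.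
  rewrite ler_wpM2l ?mulr_ge0 // /A /u !big_ord_recl !big_ord0 !addr0.
  rewrite -[X in _ <= _ * (X + _)]real_normK ?num_real //.
  rewrite -[X in _ <= _ * (_ + (X + _))]real_normK ?num_real //.
  rewrite -[X in _ <= _ * (_ + (_ + X))]real_normK ?num_real //.
  set b0 := `|_|; set b1 := `|_|; set b2 := `|_|.
  have := sqr_ge0 (b0 - b1); have := sqr_ge0 (b0 - b2); have := sqr_ge0 (b1 - b2).
  nra.
have ut0 : u t0 = 0 by rewrite /u big1 // => i _; rewrite /d subrr expr0n.
move=> t; apply/matrixP => i j; rewrite ord1.
have /eqP := gronwall_zero _ _ _ _ _ ud u0 duC ut0 t.
rewrite psumr_eq0 => [/allP/(_ j)|k _]; last exact: sqr_ge0.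
by rewrite mem_index_enum sqrf_eq0 subr_eq0 => /(_ isT)/eqP.
Qed.

(** * Periodic orbits on the parallels *)

Lemma vec3E (K : realType) (v : 'rV[K]_3) :
  v = vec3 (v ord0 (@Ordinal 3 0 isT)) (v ord0 (@Ordinal 3 1 isT))
           (v ord0 (@Ordinal 3 2 isT)).
Proof.
apply/rowP => i; rewrite mxE; case: i => [[|[|[|//]]] i3] /=;
  by congr (v _ _); apply/val_inj.
Qed.

(** For z^2 = 1 the torus equation reduces to w^2 = 0. *)
Lemma parallel_onP (K : realType) (a k : K) (v : 'rV[K]_3) : k ^+ 2 = 1 ->
  parallel_on a k v <-> exists x y, x ^+ 2 + y ^+ 2 = a ^+ 2 /\ v = vec3 x y k.
Proof.
move=> k1; rewrite /parallel_on /zero_set /setI /=; split.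
  rewrite (vec3E K v) !eval_vec3 torus_polyE /cylinder /plane_poly.
  set x := v _ _; set y := v _ _; set z := v _ _.
  rewrite !(expr2, mevalE3) => -[+ /eqP]; rewrite subr_eq0 => + /eqP zk.
  rewrite zk -!expr2 k1 subrr addr0 => /eqP.
  rewrite sqrf_eq0 subr_eq0 => /eqP xy; exists x, y.
  by split.
move=> [x [y [xy ->]]]; rewrite !eval_vec3 torus_polyE /cylinder /plane_poly.
rewrite !(expr2, mevalE3) -!expr2 xy k1 !subrr; split => //.
by rewrite expr0n addr0.
Qed.

Lemma parallel_periodic_orbit (K : realType) (a k : K) (chi : vfield K)
    (g : {mpoly K[3]}) : 0 < a -> k ^+ 2 = 1 ->
  (forall x y, x ^+ 2 + y ^+ 2 = a ^+ 2 ->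
    [/\ eval_at (tnth chi (@Ordinal 3 0 isT)) (vec3 x y k) =
          y * eval_at g (vec3 x y k),
        eval_at (tnth chi (@Ordinal 3 1 isT)) (vec3 x y k) =
          - x * eval_at g (vec3 x y k) &
        eval_at (tnth chi (@Ordinal 3 2 isT)) (vec3 x y k) = 0]) ->
  is_periodic_orbit chi (parallel_on a k) <->
  ~ (exists x y : K, x ^+ 2 + y ^+ 2 = a ^+ 2 /\ eval_at g (vec3 x y k) = 0).
Proof.
move=> a0 k1 chiE.
have sqr_le (x y : K) : x ^+ 2 + y ^+ 2 = a ^+ 2 -> `|x| <= a /\ `|y| <= a.
  move=> xy; split; rewrite -(@ler_pXn2r _ 2) ?nnegrE ?normr_ge0 ?(ltW a0) //.
    by rewrite real_normK ?num_real // -xy lerDl sqr_ge0.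
  by rewrite real_normK ?num_real // -xy lerDr sqr_ge0.
have vec3_coord (x y z : K) i : vec3 x y z ord0 i = tnth [tuple x; y; z] i.
  by rewrite mxE.
split.
  move=> [gamma [T [sol T0 per [t1 t1_neq] rng]]] [x [y [xy g0]]].
  have gamma_par t : exists x y, x ^+ 2 + y ^+ 2 = a ^+ 2 /\ gamma t = vec3 x y k.
    by apply/(parallel_onP K a k _ k1); rewrite -rng; exists t.
  have [t0 _ t0E] : range gamma (vec3 x y k).
    by rewrite rng; apply/(parallel_onP K a k _ k1); exists x, y.
  suff gamma_cst t : gamma t = gamma t0 by apply: t1_neq; rewrite !gamma_cst.
  (* On the parallel |x| and |y| are at most a and |z| = 1, so a + 1 bounds every coordinate. *)
  apply: (@bounded_solution_equilibrium K chi gamma (a + 1)) => //.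
    move=> s i; have [x' [y' [/sqr_le[x'a y'a] ->]]] := gamma_par s.
    have k1n : `|k| = 1.
      by apply/eqP; rewrite -(@eqrXn2 _ 2) ?normr_ge0 // real_normK ?num_real // k1 expr1n.
    rewrite vec3_coord; case: i => [[|[|[|//]]] i3]; rewrite /tnth /=.
    - by rewrite (le_trans x'a) // lerDl.
    - by rewrite (le_trans y'a) // lerDl.
    - by rewrite k1n lerDr ltW.
  have [e0 e1 e2] := chiE x y xy; rewrite g0 !mulr0 in e0 e1.
  move=> i; rewrite t0E; case: i => [[|[|[|//]]] i3].
  - by rewrite -[RHS]e0; congr (eval_at (tnth _ _) _); apply/val_inj.
  - by rewrite -[RHS]e1; congr (eval_at (tnth _ _) _); apply/val_inj.
  - by rewrite -[RHS]e2; congr (eval_at (tnth _ _) _); apply/val_inj.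
move=> nozero.
have circ (e t : K) : e ^+ 2 = 1 -> (a * cos t) ^+ 2 + (e * (a * sin t)) ^+ 2 = a ^+ 2.
  by move=> e1; rewrite !exprMn e1 mul1r -mulrDr cos2Dsin2 mulr1.
pose h t := eval_at g (vec3 (a * cos t) (1 * (a * sin t)) k).
have sg_cont (e : K) : continuous (fun t => eval_at g (vec3 (a * cos t) (e * (a * sin t)) k)).
  apply: (@continuous_meval K 3 g
    (fun t i => vec3 (a * cos t) (e * (a * sin t)) k ord0 i)) => i.
  have ac : continuous (fun t : K => a * cos t).
    by move=> t; apply: cvgM; [exact: cvg_cst|exact: continuous_cos].
  have as_ : continuous (fun t : K => e * (a * sin t)).
    move=> t; apply: cvgM; first exact: cvg_cst.
    by apply: cvgM; [exact: cvg_cst|exact: continuous_sin].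
  under eq_fun do rewrite vec3_coord.
  by case: i => [[|[|[|//]]] i3]; rewrite /tnth //=; exact: cst_continuous.
have h_neq0 t : h t != 0.
  apply/eqP => ht; apply: nozero.
  by exists (a * cos t), (1 * (a * sin t)); rewrite circ ?expr1n.
(* Moving clockwise (e = -1) or counterclockwise (e = 1) according to the sign
   of g makes the angular speed -e * g positive. *)
have [e [e1 e_pos]] : exists e : K, e ^+ 2 = 1 /\
    forall t, 0 < - e * eval_at g (vec3 (a * cos t) (e * (a * sin t)) k).
  have [hp|hn] := continuous_neq0_sign K h (sg_cont 1) h_neq0.
    exists (- 1); rewrite sqrrN expr1n; split => // t.
    (* For e = -1 the point of angle t is the point of angle -t in the parametrization of [h]. *)
    have := hp (- t); rewrite /h cosN sinN mul1r opprK mul1r mulrN.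
    by rewrite mulN1r.
  exists 1; rewrite expr1n; split=> // t.
  by rewrite mulN1r oppr_gt0; exact: hn.
pose w t := - e * eval_at g (vec3 (a * cos t) (e * (a * sin t)) k).
have wc : continuous w.
  by move=> t; apply: cvgM; [exact: cvg_cst|exact: sg_cont].
have pi2 : 0 < pi *+ 2 :> K by rewrite pmulrn_lgt0 // pi_gt0.
have wp t : w (t + pi *+ 2) = w t by rewrite /w cosD2pi sinD2pi.
have [theta [T [T0 theta_d theta_p theta_s]]] := periodic_flow K w _ pi2 wc e_pos wp.
pose gamma t := vec3 (a * cos (theta t)) (e * (a * sin (theta t))) k.
exists gamma, T; split=> //.
- apply/is_solutionP => t i.
  have [] := chiE _ _ (circ e (theta t) e1); rewrite -/(gamma t) => e0 e2 e3.
  have td := theta_d t.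
  rewrite /gamma; under eq_fun do rewrite vec3_coord.
  case: i => [[|[|[|//]]] i3].
  + rewrite (_ : Ordinal i3 = @Ordinal 3 0 isT) ?e0; last exact/val_inj.
    rewrite /tnth /=.
    have cd : is_derive t (1 : K) (fun s => cos (theta s)) (- sin (theta t) * w (theta t)).
      exact: (@is_derive1_comp K cos theta).
    apply: is_derive_eq; rewrite /w -/(gamma t) /GRing.scale /=; ring.
  + rewrite (_ : Ordinal i3 = @Ordinal 3 1 isT) ?e2; last exact/val_inj.
    rewrite /tnth /=.
    have sd : is_derive t (1 : K) (fun s => sin (theta s)) (cos (theta t) * w (theta t)).
      exact: (@is_derive1_comp K sin theta).
    apply: is_derive_eq; rewrite /w -/(gamma t) /GRing.scale /=.
    (* The derivative of e a sin(theta) brings a second factor e, from the angular speed -e g. *)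
    transitivity (- (a * cos (theta t)) * eval_at g (gamma t) * e ^+ 2); first ring.
    by rewrite e1 mulr1.
  + rewrite (_ : Ordinal i3 = @Ordinal 3 2 isT) ?e3; last exact/val_inj.
    by rewrite /tnth /=; exact: is_derive_cst.
- by move=> t; rewrite /gamma theta_p cosD2pi sinD2pi.
(* Half a turn later the orbit is at the antipodal point; were it the same point, x = y = 0 would
   contradict a > 0. *)
- have [s s_th] := theta_s (theta 0 + pi); exists s; rewrite /gamma s_th.
  rewrite cosDpi sinDpi => /rowP v.
  have := v (@Ordinal 3 0 isT); have := v (@Ordinal 3 1 isT).
  rewrite !vec3_coord /tnth /= => ey ex.
  have c0 : a * cos (theta 0) = 0 by move: ex; rewrite mulrN; lra.
  have s0 : e * (a * sin (theta 0)) = 0 by move: ey; rewrite !mulrN; lra.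
  have := circ e (theta 0) e1; rewrite c0 s0 expr0n addr0 => /esym/eqP.
  by rewrite sqrf_eq0 gt_eqF.
- rewrite eqEsubset; split=> v.
    move=> [t _ <-]; apply/(parallel_onP K a k _ k1).
    by exists (a * cos (theta t)), (e * (a * sin (theta t))); rewrite circ.
  move=> /(parallel_onP K a k _ k1)[x [y [xy ->]]].
  have [|t [xt yt]] := @circle_param K a x (e * y) a0.
    by rewrite exprMn e1 mul1r.
  have [s st] := theta_s t; exists s => //.
  by rewrite /gamma st -xt -yt mulrA -expr2 e1 mul1r.
Qed.

Theorem theorem2p6 (K : realType) (a : K) (P Q R : {mpoly K[3]}) :
  1 < a ->
  vf_degree [tuple P; Q; R] = 3%N ->
  invariant_surface [tuple P; Q; R] (torus_poly a) ->
  has_exactly_invariant_parallel_planes [tuple P; Q; R] 2 ->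
  exists (f : {mpoly K[3]}) (p q : K),
    (degree f <= 2)%N /\
    P = 2^-1 *: (varx * varz * (p *: varx + q *: vary)) + f * vary
        - (a ^+ 2 * p / 2) *: varz /\
    Q = 2^-1 *: (vary * varz * (p *: varx + q *: vary)) - f * varx
        - (a ^+ 2 * q / 2) *: varz /\
    R = (p *: varx + q *: vary) * (varz ^+ 2 - 1) /\
    (forall k : K,
       invariant_parallel_plane [tuple P; Q; R] k <-> k = 1 \/ k = -1) /\
    (is_periodic_orbit [tuple P; Q; R] (parallel_on a 1) <->
       ~ (exists x y : K, x ^+ 2 + y ^+ 2 = a ^+ 2 /\
            eval_at f (vec3 x y 1) - 2^-1 * (p * y - q * x) = 0)) /\
    (is_periodic_orbit [tuple P; Q; R] (parallel_on a (-1)) <->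
       ~ (exists x y : K, x ^+ 2 + y ^+ 2 = a ^+ 2 /\
            eval_at f (vec3 x y (-1)) + 2^-1 * (p * y - q * x) = 0)).
Proof.
move=> a1 deg inv planes.
have deg3 i : (msize (tnth [tuple P; Q; R] i) <= 4)%N.
  by apply: msize_degree; rewrite deg.
have P4 : (msize P <= 4)%N := deg3 (@Ordinal 3 0 isT).
have Q4 : (msize Q <= 4)%N := deg3 (@Ordinal 3 1 isT).
have R4 : (msize R <= 4)%N := deg3 (@Ordinal 3 2 isT).
have [R0 [k [l dvdR]]] := two_planes_dvd _ _ _ _ planes.
have [f [p [q [f2 PE QE RE]]]] :=
  torus_field_two_planes _ _ _ _ _ k l a1 P4 Q4 R4 inv dvdR.
(* Both parallels at once, with z = e. Replacing a^2 by x^2 + y^2 in P and Q there leaves g y and -g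
   x, where g = f - (e/2) (p y - q x). *)
have orbit (e : K) : e ^+ 2 = 1 ->
    is_periodic_orbit [tuple P; Q; R] (parallel_on a e) <->
    ~ (exists x y : K, x ^+ 2 + y ^+ 2 = a ^+ 2 /\
         eval_at f (vec3 x y e) - e * (2^-1 * (p * y - q * x)) = 0).
  move=> e1; pose g := f - e *: (2^-1 *: (p *: vary - q *: varx)).
  have gE x y : eval_at g (vec3 x y e) =
      eval_at f (vec3 x y e) - e * (2^-1 * (p * y - q * x)).
    by rewrite !eval_vec3 /g !mevalE3.
  have a0 : 0 < a by lra.
  rewrite (@parallel_periodic_orbit K a e _ g a0 e1).
    split=> no [x [y [xy z]]]; apply: no; exists x, y.
      by rewrite gE.
    by rewrite -gE.
  move=> x y xy.
  rewrite gE -[tnth _ (@Ordinal 3 0 isT)]/P -[tnth _ (@Ordinal 3 1 isT)]/Q.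
  rewrite -[tnth _ (@Ordinal 3 2 isT)]/R PE QE RE !eval_vec3 !(expr2, mevalE3).
  rewrite -!expr2 -xy e1 subrr mulr0.
  split=> //; ring.
exists f, p, q; do 4![split=> //]; split.
  by move=> k'; exact: invariant_parallel_plane_iff RE.
split; [have := orbit 1 (expr1n _ _)|have := orbit (- 1)]; last first.
  rewrite sqrrN expr1n => /(_ erefl) ->.
  by split=> no [x [y [xy z]]]; apply: no; exists x, y; split=> //; rewrite -z; ring.
move=> ->.
by split=> no [x [y [xy z]]]; apply: no; exists x, y; split=> //; rewrite -z; ring.
Qed.
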